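(* Let $R$ be a finite-dimensional algebra over a field with infinite dominant dimension. Then the following are equivalent: (i) $R$ is self-injective. (ii) All acyclic complexes of injective $R$-modules are totally acyclic, and all acyclic complexes of injective $R^{op}$-modules are totally acyclic. (iii) All acyclic complexes of projective $R$-modules are totally acyclic, and all acyclic complexes of projective $R^{op}$-modules are totally acyclic.
   Context: ''$R$-module'' means left $R$-module, and $R^{op}$ is the opposite ring, so $R^{op}$-modules are right $R$-modules. Modules are arbitrary (not necessarily finitely generated). A finite-dimensional algebra $R$ has infinite dominant dimension if, in a minimal injective coresolution $0\to R\to E^0(R)\to\cdots\to E^i(R)\to\cdots$ of the $R$-module $R$, all the $E^i(R)$ are projective. $R$ is self-injective if $R$ is injective as an $R$-module. An acyclic (i.e. exact, unbounded in both directions) complex $X^\bullet$ of projective (resp. injective) modules over a ring $S$ (here $S=R$ or $S=R^{op}$) is totally acyclic if $\mathrm{Hom}_S(X^\bullet,M)$ (resp. $\mathrm{Hom}_S(M,X^\bullet)$) is exact for every projective (resp. injective) $S$-module $M$. *)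

(* Defs.v *)
From mathcomp Require Import all_boot all_order all_algebra all_field.

Set Implicit Arguments.
Unset Strict Implicit.
Unset Printing Implicit Defensive.

Import GRing.Theory.
Local Open Scope ring_scope.

(* A module over a ring S is an lmodType S, that is,                          *)
(* an arbitrary (not necessarily finitely generated) left S-module; right     *)
(* S-modules are left modules over the converse ring S^c.                     *)

Section Modules.
Variable S : pzRingType.

Definition injective_mod (E : lmodType S) : Prop :=
  forall (A B : lmodType S) (f : {linear A -> B}) (g : {linear A -> E}),
    injective f -> exists h : {linear B -> E}, h \o f =1 g.

Definition projective_mod (P : lmodType S) : Prop :=
  forall (A B : lmodType S) (f : {linear A -> B}) (g : {linear P -> B}),
    (forall b, exists a, f a = b) -> exists h : {linear P -> A}, f \o h =1 g.

Definition exact_at (A B C : lmodType S) (f : {linear A -> B})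
    (g : {linear B -> C}) : Prop :=
  forall b, g b = 0 <-> exists a, f a = b.

Definition essential (E : lmodType S) (N : {pred E}) : Prop :=
  forall U : {pred E}, submod_closed U ->
    (exists2 u, u \in U & u != 0) ->
    exists u, [/\ u \in U, u \in N & u != 0].

(* By exactness, the kernel of icores_diff i is the image of M (for i = 0) or *)
(* of the preceding term (for i > 0), so icores_min says that every term is   *)
(* an injective envelope of the cosyzygy embedded in it.                      *)
Record min_inj_cores (M : lmodType S) := MinInjCores {
  icores_term :> nat -> lmodType S;
  icores_aug : {linear M -> icores_term 0};
  icores_diff : forall i, {linear icores_term i -> icores_term i.+1};
  icores_aug_inj : injective icores_aug;
  icores_exact0 : exact_at icores_aug (icores_diff 0);
  icores_exactS : forall i, exact_at (icores_diff i) (icores_diff i.+1);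
  icores_inj : forall i, injective_mod (icores_term i);
  icores_min : forall i, essential [pred x | icores_diff i x == 0]
}.

Record complex := Complex {
  cterm :> int -> lmodType S;
  cdiff : forall i, {linear cterm i -> cterm (i + 1)};
  cdiff_comp0 : forall i x, cdiff (i + 1) (cdiff i x) = 0
}.

(* Exactness is stated at the term of index i + 1; as i ranges over all of    *)
(* int, this covers every term.                                               *)
Definition acyclic (X : complex) : Prop :=
  forall i : int, exact_at (cdiff X i) (cdiff X (i + 1)).

(* Exactness of the complex of abelian groups Hom(X, M).                      *)
Definition Hom_to_exact (X : complex) (M : lmodType S) : Prop :=
  forall (i : int) (phi : {linear X (i + 1) -> M}),
    (forall x, phi (cdiff X i x) = 0) <->
    exists psi : {linear X (i + 1 + 1) -> M}, psi \o cdiff X (i + 1) =1 phi.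

(* Exactness of the complex of abelian groups Hom(M, X).                      *)
Definition Hom_from_exact (M : lmodType S) (X : complex) : Prop :=
  forall (i : int) (phi : {linear M -> X (i + 1)}),
    (forall m, cdiff X (i + 1) (phi m) = 0) <->
    exists psi : {linear M -> X i}, cdiff X i \o psi =1 phi.

Definition acyclic_proj (X : complex) : Prop :=
  acyclic X /\ forall i, projective_mod (X i).

Definition acyclic_inj (X : complex) : Prop :=
  acyclic X /\ forall i, injective_mod (X i).

Definition totally_acyclic_proj (X : complex) : Prop :=
  acyclic_proj X /\
  forall M : lmodType S, projective_mod M -> Hom_to_exact X M.

Definition totally_acyclic_inj (X : complex) : Prop :=
  acyclic_inj X /\
  forall M : lmodType S, injective_mod M -> Hom_from_exact M X.

End Modules.

Definition self_injective (S : nzRingType) : Prop :=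
  injective_mod (S^o : lmodType S).

Definition infinite_dominant_dimension (S : nzRingType) : Prop :=
  exists E : min_inj_cores (S^o : lmodType S), forall i, projective_mod (E i).

(* Main.v *)
(* For (iii) => (i), a coresolution 0 -> R -> E^0 -> E^1 -> ... with projective
   terms is itself an acyclic complex of projectives; total acyclicity extends
   the identity of R to E^0, so that R is a direct summand of E^0.
   For (ii) => (i), apply the K-duality D to this complex: total acyclicity
   lifts the identity of D R along D E^0 -> D R, and dualizing the lifting
   splits R -> E^0 because D D R = R.

   That (i) implies (ii) and (iii) holds because R is then quasi-Frobenius: on
   both sides, arbitrary projective modules are injective and conversely. If
   R is injective on one side, then D R is finitely generated projective on the
   other. It is also a generator there: writing t(I) for the trace ideal of the
   bimodule I (D R), an ideal I is determined by t(I) because R is the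
   endomorphism ring of D R; so t is strictly increasing on the ideals of the
   finite-dimensional algebra R and hence t(R) = R. *)

From HB Require Import structures.
Require Import Defs.
From mathcomp Require Import all_boot all_order all_algebra all_field.
From mathcomp Require Import boolp classical_sets.

Set Implicit Arguments.
Unset Strict Implicit.
Unset Printing Implicit Defensive.

Import GRing.Theory.
Local Open Scope ring_scope.

(** * Vector spaces over a field *)

Section LinearMaps.
Variables (S : pzRingType) (A B : lmodType S).

Definition linear_map (f : A -> B) (f_lin : linear f) : {linear A -> B} :=
  HB.pack f (GRing.isLinear.Build S A B _ f f_lin).

Lemma linear_mapE (f : A -> B) (f_lin : linear f) x :
  linear_map f_lin x = f x.
Proof. by []. Qed.

End LinearMaps.

Section VectorSpaces.
Variable K : fieldType.

(** By Zorn's lemma, take [W] maximal among the linear subsets meeting [N] only in 0. If [b] were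
    outside [N + W], then [W + K b] would be larger and still meet [N] trivially. *)
Lemma exists_complement (B : lmodType K) (N : B -> Prop) :
    N 0 -> (forall k x y, N x -> N y -> N (k *: x + y)) ->
  exists W : B -> Prop, [/\ W 0, forall k x y, W x -> W y -> W (k *: x + y),
    forall x, N x -> W x -> x = 0 &
    forall b, exists x, N x /\ W (b - x)].
Proof.
move=> N0 Nlin.
have NZ k x : N x -> N (k *: x).
  by move=> Nx; rewrite -[_ *: _]addr0; apply: Nlin.
(* The condition [W 0] is left out of [P] because the union of the empty chain is empty; it follows
   afterwards from maximality, by comparison with [{0}]. *)
pose P (W : set B) := (forall k x y, W x -> W y -> W (k *: x + y)) /\
  (forall x, N x -> W x -> x = 0).
have [|W [[Wlin WN] Wmax]] := @Zorn_bigcup B P.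
  move=> F FP Ftot; split=> [k x y [X FX Xx] [Y FY Yy]|x Nx [X FX Xx]].
    have [XY|YX] := Ftot X Y FX FY.
      by exists Y => //; apply: (FP _ FY).1 => //; apply: XY.
    by exists X => //; apply: (FP _ FX).1 => //; apply: YX.
  exact: (FP _ FX).2.
have W0 : W 0.
  apply: contrapT => nW0; apply: (Wmax [set 0]%classic).
    split=> [x Wx|/(_ 0 erefl)//]; case: nW0.
    by rewrite -[0](addNr x) -scaleN1r; apply: Wlin.
  by split=> [k x y -> ->|x _ ->] //; rewrite scaler0 addr0.
exists W; split=> // b; apply: contrapT => nb.
pose W' : set B := fun x => exists k, W (x - k *: b).
apply: (Wmax W').
  split=> [x Wx|]; first by exists 0; rewrite scale0r subr0.
  move=> W'W; apply: nb; exists 0; split=> //; rewrite subr0.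
  by apply: W'W; exists 1; rewrite scale1r subrr.
split=> [k x y [k1 Wx] [k2 Wy]|x Nx [k Wx]].
  exists (k * k1 + k2).
  rewrite scalerDl -scalerA opprD addrACA -scalerBr; exact: Wlin.
have [k0|k0] := eqVneq k 0.
  by apply: WN => //; move: Wx; rewrite k0 scale0r subr0.
case: nb; exists (k^-1 *: x); split; first exact: NZ.
have -> : b - k^-1 *: x = (- k^-1) *: (x - k *: b) + 0.
  by rewrite addr0 scalerBr !scaleNr scalerA mulVf // scale1r opprK addrC.
exact: Wlin.
Qed.

(** The extension is zero on a complement of the image of [f], and on the image it is [g] of any
    preimage: two preimages differ by an element of the kernel of [f]. *)
Lemma vector_space_extension (A B V : lmodType K) (f : {linear A -> B})
    (g : {linear A -> V}) :
  (forall a, f a = 0 -> g a = 0) -> exists h : {linear B -> V}, h \o f =1 g.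
Proof.
move=> fg.
have [|k x y [a <-] [b <-]|W [W0 Wlin WN WB]] :=
  @exists_complement B (fun b => exists a, f a = b).
- by exists 0; rewrite linear0.
- by exists (k *: a + b); rewrite linearP.
have /choice[s sP] b : exists a, W (b - f a).
  by have [_ [[a <-] Wb]] := WB b; exists a.
have gE a b : W (b - f a) -> g (s b) = g a.
  move=> Wb; apply/eqP; rewrite -subr_eq0 -linearB; apply/eqP/fg/WN.
    by exists (s b - a).
  rewrite linearB.
  have -> : f (s b) - f a = (-1) *: (b - f (s b)) + (b - f a).
    by rewrite scaleN1r opprB addrA subrK.
  exact: Wlin.
have hlin : linear (fun b => g (s b)).
  move=> k x y; rewrite -linearP; apply: gE.
  rewrite linearP opprD addrACA -scalerBr; exact: Wlin.
exists (linear_map hlin) => a /=; apply: gE; rewrite subrr; exact: W0.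
Qed.

Lemma vector_space_injective (V : lmodType K) : injective_mod V.
Proof.
move=> A B f g f_inj; apply: vector_space_extension => a.
by rewrite -[X in _ = X -> _](linear0 f) => /f_inj ->; rewrite linear0.
Qed.

(** On a complement of its kernel [f] is bijective, so [g v] has a unique preimage there, and
    uniqueness makes the lift linear. *)
Lemma vector_space_projective (V : lmodType K) : projective_mod V.
Proof.
move=> A B f g f_surj.
have [|k x y fx fy|W [W0 Wlin WN WA]] :=
  @exists_complement A (fun a => f a = 0).
- exact: linear0.
- by rewrite linearP fx fy scaler0 addr0.
have /choice[s sP] v : exists a, W a /\ f a = g v.
  have [a fa] := f_surj (g v); have [n [fn Wn]] := WA a.
  by exists (a - n); split=> //; rewrite linearB fn subr0.
have slin : linear s.
  move=> k x y; apply/eqP; rewrite -subr_eq0; apply/eqP/WN.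
    rewrite linearB linearP !(sP _).2 linearP subrr //.
  rewrite [X in W X]addrC -scaleN1r; apply: (Wlin); last exact: (sP _).1.
  by apply: Wlin; exact: (sP _).1.
by exists (linear_map slin) => v /=; rewrite (sP v).2.
Qed.

End VectorSpaces.

(** * Restriction of scalars and Hom over the ground field *)

Section ConverseAlgebra.
Variables (K : fieldType) (R : falgType K).

HB.instance Definition _ := GRing.Zmodule_isLmodule.Build K R^c
  (@scalerA K R) (@scale1r K R) (@scalerDr K R) (@scalerDl K R).

Fact converse_scalerAl (k : K) (x y : R^c) : k *: (x * y) = (k *: x : R^c) * y.
Proof. exact: (scalerAr k (y : R) x). Qed.

HB.instance Definition _ :=
  GRing.Lmodule_isLalgebra.Build K R^c converse_scalerAl.

Fact converse_scalerAr (k : K) (x y : R^c) : k *: (x * y) = x * (k *: y : R^c).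
Proof. exact: (scalerAl k (y : R) x). Qed.

HB.instance Definition _ :=
  GRing.Lalgebra_isAlgebra.Build K R^c converse_scalerAr.

Import VectorInternalTheory.

Fact converse_finDim : Vector.axiom (dim R) R^c.
Proof.
exists (v2r : R -> _); last exact: Bijective v2rK r2vK.
exact: (linearPZ (v2r (vT := R))).
Qed.

HB.instance Definition _ := Lmodule_hasFinDim.Build K R^c converse_finDim.

End ConverseAlgebra.

Section Restriction.
Variables (K : fieldType) (S : algType K).

(** An alias, so that the action of [K] through [k%:A] stays apart from the action of [S] on the
    same group. *)
Definition restr (A : lmodType S) : Type := A.

Section Def.
Variable A : lmodType S.

HB.instance Definition _ := GRing.Zmodule.copy (restr A) A.

Definition restr_scale (k : K) (a : restr A) : restr A := k%:A *: (a : A).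

Fact restr_scalerA a b v :
  restr_scale a (restr_scale b v) = restr_scale (a * b) v.
Proof. by rewrite /restr_scale scalerA -scalerAl mul1r scalerA. Qed.
Fact restr_scale1r : left_id 1 restr_scale.
Proof. by move=> v; rewrite /restr_scale !scale1r. Qed.
Fact restr_scalerDr : right_distributive restr_scale +%R.
Proof. by move=> k u v; rewrite /restr_scale scalerDr. Qed.
Fact restr_scalerDl v : {morph restr_scale^~ v : a b / a + b}.
Proof. by move=> a b; rewrite /restr_scale !scalerDl. Qed.

HB.instance Definition _ := GRing.Zmodule_isLmodule.Build K (restr A)
  restr_scalerA restr_scale1r restr_scalerDr restr_scalerDl.

Lemma restrZ (k : K) (a : restr A) : k *: a = k%:A *: (a : A).
Proof. by []. Qed.

End Def.

Lemma restr_scale_comm (A : lmodType S) (s : S) (k : K) (a : A) :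
  s *: (k *: (a : restr A) : A) = (k *: (s *: a : restr A) : A).
Proof. by rewrite !restrZ !scalerA -scalerAl -scalerAr mulr1 mul1r. Qed.

Fact restr_map_linear (A B : lmodType S) (f : {linear A -> B}) :
  linear (f : restr A -> restr B).
Proof. move=> k x y; rewrite !restrZ; exact: linearP. Qed.

Definition restr_map (A B : lmodType S) (f : {linear A -> B}) :
  {linear restr A -> restr B} := linear_map (@restr_map_linear A B f).

End Restriction.

(** An isomorphism of [S] with the opposite ring of [T]. Keeping it abstract treats left and right
    alike: with [anti_sym], each result below serves both sides. *)
Record anti_iso (K : fieldType) (S T : algType K) := AntiIso {
  anti_fun :> {linear S -> T};
  anti_inv : {linear T -> S};
  anti1 : anti_fun 1 = 1;
  antiM : forall x y, anti_fun (x * y) = anti_fun y * anti_fun x;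
  antiK : cancel anti_fun anti_inv;
  antiVK : cancel anti_inv anti_fun
}.

Section AntiInverse.
Variables (K : fieldType) (S T : algType K) (op : anti_iso S T).

Fact antiV1 : anti_inv op 1 = 1.
Proof. by rewrite -(anti1 op) antiK. Qed.

Fact antiVM x y : anti_inv op (x * y) = anti_inv op y * anti_inv op x.
Proof. by rewrite -{1}(antiVK op x) -{1}(antiVK op y) -antiM antiK. Qed.

Definition anti_sym : anti_iso T S :=
  AntiIso antiV1 antiVM (antiVK op) (antiK op).

End AntiInverse.

Definition converse_anti (K : fieldType) (R : falgType K) : anti_iso R R^c :=
  @AntiIso K R R^c (@idfun R) (@idfun R) erefl (fun _ _ => erefl)
    (fun _ => erefl) (fun _ => erefl).

(* Hom_K(Q, V), on which S, the opposite of T, acts through its action on Q;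
   [op] is a parameter of the type because it determines that action. *)
Record homK (K : fieldType) (S T : algType K) (op : anti_iso S T)
    (Q : lmodType T) (V : lmodType K) := HomK {
  homK_fun :> restr Q -> V;
  homK_linear : linear homK_fun
}.
Arguments HomK {K S T op Q V} [homK_fun] _.

Section HomK.
Variables (K : fieldType) (S T : algType K) (op : anti_iso S T).

Section Def.
Variables (Q : lmodType T) (V : lmodType K).
Local Notation homK := (homK op Q V).
Local Notation HomK := (@HomK K S T op Q V _).

HB.instance Definition _ := gen_eqMixin homK.
HB.instance Definition _ := gen_choiceMixin homK.

Lemma homK_ext (f g : homK) : f =1 g -> f = g.
Proof.
case: f g => f fL [g gL] /= /funext fg; move: fL gL.
by rewrite fg => fL gL; congr HomK; apply: Prop_irrelevance.
Qed.

Definition homK_map (f : homK) : {linear restr Q -> V} :=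
  linear_map (homK_linear f).

Lemma homKP (f : homK) k x y : f (k *: x + y) = k *: f x + f y.
Proof. exact: homK_linear. Qed.
Lemma homKD (f : homK) x y : f (x + y) = f x + f y.
Proof. exact: (linearD (homK_map f)). Qed.
Lemma homKZ (f : homK) k x : f (k *: x) = k *: f x.
Proof. exact: (linearZZ (homK_map f)). Qed.
Lemma homK0r (f : homK) : f 0 = 0.
Proof. exact: (linear0 (homK_map f)). Qed.
Lemma homK_sumr (f : homK) I r (P : pred I) (F : I -> restr Q) :
  f (\sum_(i <- r | P i) F i) = \sum_(i <- r | P i) f (F i).
Proof. exact: (linear_sum (homK_map f)). Qed.

Fact homK0_subproof : linear (fun _ : restr Q => 0 : V).
Proof. by move=> k x y; rewrite scaler0 addr0. Qed.
Fact homKN_subproof (f : homK) : linear (fun x => - f x).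
Proof. by move=> k x y; rewrite homKP opprD scalerN. Qed.
Fact homKD_subproof (f g : homK) : linear (fun x => f x + g x).
Proof. by move=> k x y; rewrite !homKP scalerDr addrACA. Qed.
Fact homKZ_subproof (s : S) (f : homK) :
  linear (fun x : restr Q => f (op s *: (x : Q)) : V).
Proof. by move=> k x y; rewrite scalerDr restr_scale_comm homKP. Qed.

Fact homK_addA : associative (fun f g => HomK (homKD_subproof f g)).
Proof. by move=> f g h; apply: homK_ext => x /=; rewrite addrA. Qed.
Fact homK_addC : commutative (fun f g => HomK (homKD_subproof f g)).
Proof. by move=> f g; apply: homK_ext => x /=; rewrite addrC. Qed.
Fact homK_add0 :
  left_id (HomK homK0_subproof) (fun f g => HomK (homKD_subproof f g)).
Proof. by move=> f; apply: homK_ext => x /=; rewrite add0r. Qed.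
Fact homK_addN : left_inverse (HomK homK0_subproof)
  (fun f => HomK (homKN_subproof f)) (fun f g => HomK (homKD_subproof f g)).
Proof. by move=> f; apply: homK_ext => x /=; rewrite addNr. Qed.

HB.instance Definition _ :=
  GRing.isZmodule.Build homK homK_addA homK_addC homK_add0 homK_addN.

Let scale (s : S) (f : homK) := HomK (homKZ_subproof s f).

Fact homK_scalerA a b f : scale a (scale b f) = scale (a * b) f.
Proof. by apply: homK_ext => x /=; rewrite scalerA antiM. Qed.
Fact homK_scale1r : left_id 1 scale.
Proof. by move=> f; apply: homK_ext => x /=; rewrite anti1 scale1r. Qed.
Fact homK_scalerDr : right_distributive scale +%R.
Proof. by move=> k u v; apply: homK_ext. Qed.
Fact homK_scalerDl f : {morph scale^~ f : a b / a + b}.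
Proof.
by move=> a b; apply: homK_ext => x /=; rewrite linearD scalerDl homKD.
Qed.

HB.instance Definition _ := GRing.Zmodule_isLmodule.Build S homK
  homK_scalerA homK_scale1r homK_scalerDr homK_scalerDl.

Lemma homKDE (f g : homK) x : (f + g) x = f x + g x. Proof. by []. Qed.
Lemma homK0E x : (0 : homK) x = 0. Proof. by []. Qed.
Lemma homKZE (s : S) (f : homK) x : (s *: f) x = f (op s *: (x : Q)).
Proof. by []. Qed.
Lemma homK_sumE I r (P : pred I) (F : I -> homK) x :
  (\sum_(i <- r | P i) F i) x = \sum_(i <- r | P i) F i x.
Proof.
exact: (big_morph (fun f : homK => f x) (fun f g => homKDE f g x) (homK0E x)).
Qed.

Lemma homK_algZE (k : K) (f : homK) x : (k%:A *: f) x = k *: f x.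
Proof. by rewrite homKZE linearZ anti1 -homKZ. Qed.

Lemma homK_restrZE (k : K) (f : restr homK) x :
  (k *: f : homK) x = k *: (f : homK) x.
Proof. exact: homK_algZE. Qed.

End Def.
End HomK.

Section HomKComp.
Variables (K : fieldType) (S T : algType K) (op : anti_iso S T).
Variable V : lmodType K.

Fact homK_comp_subproof (A B : lmodType T) (f : {linear A -> B})
  (h : homK op B V) : linear (fun a : restr A => h (f a)).
Proof. by move=> k x y; rewrite (linearP (restr_map f)) homKP. Qed.

Fact homK_comp_linear (A B : lmodType T) (f : {linear A -> B}) :
  linear (fun h : homK op B V => HomK (homK_comp_subproof f h) : homK op A V).
Proof. by move=> s x y; apply: homK_ext => a; rewrite /= (linearZZ f). Qed.

Definition homK_comp (A B : lmodType T) (f : {linear A -> B}) :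
  {linear homK op B V -> homK op A V} := linear_map (homK_comp_linear f).

Lemma homK_compE (A B : lmodType T) (f : {linear A -> B}) h a :
  homK_comp f h a = h (f a).
Proof. by []. Qed.

Lemma homK_comp_surj (A B : lmodType T) (f : {linear A -> B}) :
  injective f -> forall h, exists h', homK_comp f h' = h.
Proof.
move=> f_inj h; have [h' h'E] := vector_space_injective (homK_map h)
  (f_inj : injective (restr_map f)).
by exists (HomK (linearP h')); apply: homK_ext => a; exact: h'E.
Qed.

Lemma homK_exact (A B C : lmodType T) (f : {linear A -> B})
    (g : {linear B -> C}) :
  exact_at f g -> exact_at (homK_comp g) (homK_comp f).
Proof.
move=> fg h; split=> [hf|[h' <-]]; last first.
  apply: homK_ext => a; rewrite !homK_compE (_ : g (f a) = 0) ?homK0r //.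
  by apply/fg; exists a.
have [b|h' h'E] := @vector_space_extension _ _ _ _ (restr_map g) (homK_map h).
  by move=> /fg[a <-]; exact: (congr1 (fun u => homK_fun u a) hf).
by exists (HomK (linearP h')); apply: homK_ext => b; exact: h'E.
Qed.

End HomKComp.

Section HomKInjective.
Variables (K : fieldType) (S T : algType K) (op : anti_iso S T).

(** Swapping arguments identifies S-maps from [A] to Hom_K(Q, V) with T-maps from [Q] to Hom_K(A,
    V). An injective [f] induces a surjection from Hom_K(B, V) to Hom_K(A, V), along which
    projectivity of [Q] lifts; swapping back gives the extension. *)
Lemma homK_injective (Q : lmodType T) (V : lmodType K) :
  projective_mod Q -> injective_mod (homK op Q V : lmodType S).
Proof.
move=> Qproj A B f g f_inj.
have adj1 q : linear (fun a : restr A => g a q).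
  move=> k x y.
  by rewrite (linearD g) homKDE (linearZZ (restr_map g)) homK_restrZE.
have adj2 : linear (fun q : Q => HomK (adj1 q) : homK (anti_sym op) A V).
  move=> t x y; apply: homK_ext => a.
  by rewrite homKDE homKZE /= linearZ homKZE /= antiVK homKD.
have [|h hE] := Qproj _ _ (homK_comp (anti_sym op) V f) (linear_map adj2).
  exact: homK_comp_surj.
have hL b : linear (fun q : restr Q => h q b).
  move=> k x y.
  by rewrite (linearD h) homKDE (linearZZ (restr_map h)) homK_restrZE.
have hL2 : linear (fun b : B => HomK (hL b) : homK op Q V).
  move=> s x y; apply: homK_ext => q.
  by rewrite homKDE homKZE /= homKD linearZ homKZE /= antiK.
exists (linear_map hL2) => a; apply: homK_ext => q /=.
by have /(congr1 (fun u => homK_fun u a)) := hE q.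
Qed.

End HomKInjective.

(** * Coinduced modules *)

Lemma regular_projective (S : pzRingType) : projective_mod (S^o : lmodType S).
Proof.
move=> A B f g f_surj; have [a fa] := f_surj (g 1).
have hL : linear (fun x : S^o => (x : S) *: a).
  by move=> k x y; rewrite scalerDl scalerA.
exists (linear_map hL) => x.
by rewrite /= linearZZ fa -linearZZ; congr (g _); exact: mulr1.
Qed.

Lemma retract_injective (S : pzRingType) (E P : lmodType S)
    (i : {linear P -> E}) (r : {linear E -> P}) :
  cancel i r -> injective_mod E -> injective_mod P.
Proof.
move=> iK Einj A B f g /(Einj A B f (i \o g))[h hf].
by exists (r \o h) => a /=; have /= -> := hf a.
Qed.

Lemma retract_projective (S : pzRingType) (E P : lmodType S)
    (i : {linear P -> E}) (r : {linear E -> P}) :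
  cancel i r -> projective_mod E -> projective_mod P.
Proof.
move=> iK Eproj A B f g /(Eproj A B f (g \o r))[h hf].
by exists (h \o i) => a; have /= -> := hf (i a); rewrite /= iK.
Qed.

Section DualBasis.
Variables (K : fieldType) (S T : falgType K) (op : anti_iso S T).

Local Notation coind := (homK op (T^o : lmodType T)).
Local Notation dual := (coind (K^o : lmodType K)).

Lemma restr_regularZ k (x : restr (T^o : lmodType T)) : k *: x = k *: (x : T).
Proof. by rewrite restrZ; exact: (mulr_algl k (x : T)). Qed.

Lemma homK_regularP (V : lmodType K) (f : T -> V) :
  linear f -> linear (f : restr (T^o : lmodType T) -> V).
Proof. by move=> fL k x y; rewrite restr_regularZ fL. Qed.

Lemma coind_linear (V : lmodType K) (h : coind V) : linear (h : T -> V).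
Proof. by move=> k x y; rewrite -homKP restr_regularZ. Qed.

Definition dual_coord (i : 'I_(\dim {:T})) : dual :=
  HomK (homK_regularP (V := K^o) (linearP (coord (vbasis {:T}) i))).

(** The elementary tensor of [m] and [v], when Hom_K(T, V) is identified with the tensor product of
    [dual] and [V] over [K]. *)
Definition tensor (V : lmodType K) (m : dual) (v : V) : coind V.
Proof.
apply: (@HomK _ _ _ op (T^o : lmodType T) V (fun x => (m x : K) *: v)).
by move=> k x y; rewrite homKP scalerDl scalerA.
Defined.

Lemma tensorE (V : lmodType K) (m : dual) (v : V) x :
  tensor m v x = (m x : K) *: v.
Proof. by []. Qed.

Lemma tensorZl (V : lmodType K) s (m : dual) (v : V) :
  tensor (s *: m) v = s *: tensor m v.
Proof. exact: homK_ext. Qed.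

Lemma tensor_suml (V : lmodType K) I r (P : pred I) (F : I -> dual) (v : V) :
  tensor (\sum_(i <- r | P i) F i) v = \sum_(i <- r | P i) tensor (F i) v.
Proof.
by apply: homK_ext => x; rewrite tensorE !homK_sumE scaler_suml.
Qed.

Lemma tensor_linear (V : lmodType K) (m : dual) :
  linear (tensor m : V -> restr (coind V)).
Proof.
move=> k x y; apply: homK_ext => t.
by rewrite homKDE homK_restrZE !tensorE scalerDr !scalerA mulrC.
Qed.

Lemma regular_basis (t : T) :
  t = \sum_i coord (vbasis {:T}) i t *: (vbasis {:T})`_i.
Proof. exact: coord_vbasis (memvf t). Qed.

Lemma coind_decomp (V : lmodType K) (h : coind V) :
  h = \sum_i tensor (dual_coord i) (h (vbasis {:T})`_i).
Proof.
apply: homK_ext => t; rewrite homK_sumE [in LHS](regular_basis t).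
rewrite homK_sumr; apply: eq_bigr => i _.
by rewrite tensorE -restr_regularZ homKZ.
Qed.

Lemma dual_decomp (m : dual) :
  m = \sum_(i < \dim {:T}) (m (vbasis {:T})`_i : K)%:A *: dual_coord i.
Proof.
rewrite [LHS]coind_decomp; apply: eq_bigr => i _; apply: homK_ext => t.
by rewrite homK_algZE tensorE; exact: mulrC.
Qed.

Lemma dual_separates (x y : T) : (forall m : dual, m x = m y) -> x = y.
Proof.
move=> xy; rewrite (regular_basis x) (regular_basis y); apply: eq_bigr => i _.
by congr (_ *: _); exact: (xy (dual_coord i)).
Qed.

Section Lift.
Variables (V : lmodType K) (A : lmodType S).
Variables (f : {linear dual -> S^o}) (g : {linear V -> restr A}).

Let lift (h : coind V) : A :=
  \sum_i (f (dual_coord i) : S) *: (g (h (vbasis {:T})`_i) : A).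

Let liftD h1 h2 : lift (h1 + h2) = lift h1 + lift h2.
Proof.
rewrite /lift -big_split; apply: eq_bigr => i _.
by rewrite [in LHS]/= linearD scalerDr.
Qed.

Let lift0 : lift 0 = 0.
Proof. by rewrite /lift big1 // => i _; rewrite homK0E linear0 scaler0. Qed.

Let lift_tensor m v : lift (tensor m v) = (f m : S) *: (g v : A).
Proof.
rewrite /lift [in RHS](dual_decomp m) linear_sum scaler_suml.
apply: eq_bigr => i _; rewrite tensorE linearZZ restrZ linearZZ !scalerA.
congr (_ *: _).
exact: etrans (mulr_algr _ _) (esym (mulr_algl _ _)).
Qed.

(** Elementary tensors span [coind V] and [S] acts on their first factor, so linearity reduces to
    that of [f]. *)
Fact lift_linear : linear lift.
Proof.
move=> s h1 h2; rewrite liftD; congr (_ + _).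
rewrite [in LHS](coind_decomp h1) scaler_sumr (big_morph _ liftD lift0).
rewrite [in RHS]/lift scaler_sumr; apply: eq_bigr => i _.
by rewrite -tensorZl lift_tensor linearZZ scalerA.
Qed.

(* The S-linear map with [m (x) v |-> f m *: g v], for Hom_K(T, V) seen as the
   tensor product of the dual of T with V. *)
Definition coind_lift : {linear coind V -> A} := linear_map lift_linear.

Lemma coind_liftE h : coind_lift h =
  \sum_i (f (dual_coord i) : S) *: (g (h (vbasis {:T})`_i) : A).
Proof. by []. Qed.

Lemma coind_lift_tensor m v :
  coind_lift (tensor m v) = (f m : S) *: (g v : A).
Proof. exact: lift_tensor. Qed.

End Lift.

Section Embed.
Variable E : lmodType S.

Fact coind_embed_subproof (e : E) :
  linear (fun y : T => anti_inv op y *: e : restr E).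
Proof.
by move=> k x y; rewrite linearP scalerDl -mulr_algl -scalerA.
Qed.

(** The unit of coinduction. Evaluation at 1 recovers [e], so every module embeds in a coinduced
    one, and an injective module is a direct summand of it. *)
Definition coind_embed_fun (e : E) : coind (restr E) :=
  HomK (homK_regularP (coind_embed_subproof e)).

Fact coind_embed_linear : linear coind_embed_fun.
Proof.
move=> s x y; apply: homK_ext => t.
rewrite homKDE homKZE /= scalerDr; congr (_ + _).
by rewrite antiVM antiK scalerA.
Qed.

Definition coind_embed := linear_map coind_embed_linear.

Lemma coind_embedE e y : coind_embed e y = anti_inv op y *: e.
Proof. by []. Qed.

Lemma injective_coind_retract : injective_mod E ->
  exists r : {linear coind (restr E) -> E}, cancel coind_embed r.
Proof.
move=> Einj.
have [x y /(congr1 (fun h => homK_fun h 1))|r rE] :=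
  Einj _ _ coind_embed (@idfun E).
  by rewrite !coind_embedE antiV1 !scale1r.
by exists r => e; exact: rE.
Qed.

End Embed.

Lemma coind_injective (V : lmodType K) : injective_mod (coind V : lmodType S).
Proof. exact/homK_injective/regular_projective. Qed.

(** A finite dual basis: the explicit form of [dual] being a finitely generated projective
    S-module. *)
Definition dual_finite_projective :=
  exists n (f : 'I_n -> {linear dual -> S^o}) (m : 'I_n -> dual),
  forall x, x = \sum_j (f j x : S) *: m j.

(** The values of the S-linear forms on [dual] generate the unit ideal, so that [S] is a direct
    summand of a finite power of [dual]. *)
Definition dual_generator :=
  exists L : seq ({linear dual -> S^o} * dual), \sum_(p <- L) p.1 p.2 = 1 :> S.

End DualBasis.

(** * Trace ideals *)

(** Among the subspaces contained in [P], one of maximal dimension contains every [x] in [P], since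
    adjoining the line of [x] cannot raise the dimension. *)
Lemma exists_vspace (K : fieldType) (V : vectType K) (P : V -> Prop) :
    P 0 -> (forall k x y, P x -> P y -> P (k *: x + y)) ->
  exists U : {vspace V}, forall x, x \in U <-> P x.
Proof.
move=> P0 Plin.
pose Q n :=
  `[< exists U : {vspace V}, \dim U = n /\ forall x, x \in U -> P x >].
have Q0 : exists n, Q n.
  exists 0%N; apply/asboolP; exists 0%VS; rewrite dimv0.
  by split=> // x; rewrite memv0 => /eqP->.
have Qmax n : Q n -> (n <= \dim {:V})%N.
  by move=> /asboolP[U [<- _]]; exact/dimvS/subvf.
have [n /asboolP[U [Un UP]] nmax] := ex_maxnP Q0 Qmax.
exists U => x; split=> [/UP//|Px].
have : (\dim (U + <[x]>) <= \dim U)%N.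
  rewrite Un; apply: nmax; apply/asboolP; exists (U + <[x]>)%VS; split=> // z.
  by case/memv_addP=> [u Uu [_ /vlineP[k ->] ->]]; rewrite addrC; exact/Plin/UP.
move=> dimU; have /eqP -> : U == (U + <[x]>)%VS by rewrite eqEdim addvSl.
by rewrite (subvP (addvSr _ _)) ?memv_line.
Qed.

Section TraceIdeal.
Variables (K : fieldType) (S T : falgType K) (op : anti_iso S T).

Local Notation dual := (homK op (T^o : lmodType T) (K^o : lmodType K)).

Fact dual_act_subproof (u : T) (m : dual) :
  linear (fun y : T => m (y * u) : K^o).
Proof. by move=> k x y; rewrite mulrDl -scalerAl coind_linear. Qed.

(** The second action on the bimodule [dual]; it commutes with that of [S], which multiplies the
    argument on the other side. *)
Definition dual_act_fun (u : T) (m : dual) : dual :=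
  HomK (homK_regularP (dual_act_subproof u m)).

Fact dual_act_linear u : linear (dual_act_fun u).
Proof.
move=> s x y; apply: homK_ext => t.
by rewrite homKDE homKZE /= -[in RHS]mulrA.
Qed.

Definition dual_act u : {linear dual -> dual} := linear_map (dual_act_linear u).

Lemma dual_actE u m (y : T) : dual_act u m y = m (y * u).
Proof. by []. Qed.

Lemma dual_act_inj u v : dual_act u =1 dual_act v -> u = v.
Proof.
move=> uv; apply: (@dual_separates _ _ _ op) => m.
by rewrite -[u]mul1r -[v]mul1r -!dual_actE uv.
Qed.

Lemma dual_act0 m : dual_act 0 m = 0.
Proof. by apply: homK_ext => y; rewrite dual_actE mulr0 homK0r. Qed.

Lemma dual_actP k u v m :
  dual_act (k *: u + v) m = k%:A *: dual_act u m + dual_act v m.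
Proof.
apply: homK_ext => y.
by rewrite homKDE homK_algZE !dual_actE mulrDr -scalerAr coind_linear.
Qed.

Lemma dual_actM u v m : dual_act (u * v) m = dual_act u (dual_act v m).
Proof. by apply: homK_ext => y; rewrite !dual_actE mulrA. Qed.

(** The required [u] satisfies [m u = h m 1] for every functional [m]; evaluating on the dual basis
    gives its coordinates. *)
Lemma dual_end (h : {linear dual -> dual}) : exists u, dual_act u =1 h.
Proof.
exists (\sum_(i < \dim {:T}) (h (dual_coord op i) 1 : K) *: (vbasis {:T})`_i).
move=> m; apply: homK_ext => y; rewrite dual_actE.
(* Linearity of [h] over [S] reduces evaluation at [y] to evaluation at 1. *)
have <- : h (anti_inv op y *: m) 1 = h m y.
  by rewrite linearZZ homKZE antiVK; congr (h m _); exact: mulr1.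
set u := \sum_i _.
have -> : m (y * u) = (anti_inv op y *: m) u by rewrite homKZE antiVK.
move: (_ *: m) => {}m; rewrite [in RHS](dual_decomp m) linear_sum homK_sumE.
have -> : m u = \sum_(i < \dim {:T})
    (h (dual_coord op i) 1 : K) *: m (vbasis {:T})`_i.
  rewrite /u homK_sumr; apply: eq_bigr => i _.
  by rewrite -homKZ restr_regularZ.
apply: eq_bigr => i _; rewrite linearZZ homK_algZE; exact: mulrC.
Qed.

(* The image under [op] of the trace ideal of the S-submodule [a dual] of
   [dual], on which T acts through [dual_act]. *)
Inductive trace_ideal (a : T -> Prop) : T -> Prop :=
| TraceIdeal_gen u (f : {linear dual -> S^o}) m :
    a u -> trace_ideal a (op (f (dual_act u m)))
| TraceIdeal0 : trace_ideal a 0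
| TraceIdeal_lin k x y :
    trace_ideal a x -> trace_ideal a y -> trace_ideal a (k *: x + y).

Definition two_sided_ideal (a : T -> Prop) :=
  [/\ a 0, forall k x y, a x -> a y -> a (k *: x + y),
      forall x y, a y -> a (x * y) & forall x y, a x -> a (x * y)].

Lemma trace_idealS (a b : T -> Prop) x :
  (forall y, a y -> b y) -> trace_ideal a x -> trace_ideal b x.
Proof.
move=> ab; elim=> [u f m au||k y z _ by_ _ bz].
- exact/TraceIdeal_gen/ab.
- exact: TraceIdeal0.
- exact: TraceIdeal_lin.
Qed.

(** Through [op], a left multiplication by [x] amounts to following [f] by a right multiplication of
    [S], and a right multiplication by [y] to rescaling [m]. *)
Lemma trace_ideal_ideal (a : T -> Prop) : two_sided_ideal (trace_ideal a).
Proof.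
split; first exact: TraceIdeal0.
- exact: TraceIdeal_lin.
- move=> x y; elim=> [u f m au||k z t _ xz _ xt].
  + have fL : linear (fun n => f n * anti_inv op x : S^o).
      by move=> s n1 n2; rewrite linearP mulrDl -scalerAl.
    have := TraceIdeal_gen (linear_map fL) m au.
    by rewrite linear_mapE antiM antiVK.
  + by rewrite mulr0; exact: TraceIdeal0.
  + by rewrite mulrDr -scalerAr; exact: TraceIdeal_lin.
- move=> x y; elim=> [u f m au||k z t _ xz _ xt].
  + have := TraceIdeal_gen f (anti_inv op y *: m) au.
    by rewrite !linearZZ antiM antiVK.
  + by rewrite mul0r; exact: TraceIdeal0.
  + by rewrite mulrDl -scalerAl; exact: TraceIdeal_lin.
Qed.

Hypothesis fproj : dual_finite_projective op.

(* Since [dual] is projective with endomorphism ring T, every ideal is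
   recovered from its trace ideal. *)
Lemma trace_ideal_reflect (a : T -> Prop) (w : T) :
    two_sided_ideal a ->
    (forall (f : {linear dual -> S^o}) m,
       trace_ideal a (op (f (dual_act w m)))) ->
  a w.
Proof.
move=> [a0 alin amull amulr] wa; have [n [f [m fm]]] := fproj.
have aP x y : a x -> a y -> a (x + y).
  by move=> ax ay; rewrite -[x]scale1r; exact: alin.
(* For [z] the generator given by [h], [u] and [p], the endomorphism is a composite of
   [x |-> g x *: p], the action of [u], and [q |-> h q *: m j]. The outer two are actions of
   elements of [T] by [dual_end], so the composite is the action of an element of [a]. *)
have rank1 z (g : {linear dual -> S^o}) j : trace_ideal a z ->
    exists2 u, a u &
      forall x, dual_act u x = (g x * anti_inv op z : S) *: m j.
  elim=> [u h p au||k y t _ [v av vE] _ [v' av' v'E]].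
  - have rk1L (q : dual) (e : {linear dual -> S^o}) :
        linear (fun x => (e x : S) *: q).
      by move=> s x y; rewrite linearP scalerDl scalerA.
    have [b bE] := dual_end (linear_map (rk1L p g)).
    have [c cE] := dual_end (linear_map (rk1L (m j) h)).
    exists (c * u * b); first exact/amulr/amull.
    move=> x; rewrite !dual_actM bE cE !linear_mapE antiK.
    by have /= -> := linearZZ (dual_act u) (g x) p; rewrite linearZZ.
  - by exists 0 => // x; rewrite dual_act0 linear0 mulr0 scale0r.
  - exists (k *: v + v'); first exact: alin.
    move=> x; rewrite dual_actP vE v'E linearP mulrDr scalerDl.
    by rewrite -scalerAr scalerA mulr_algl.
have /choice[v vP] (i : 'I_n * 'I_n) : exists u, a u /\
    forall x, dual_act u x =
      (f i.2 x * f i.1 (dual_act w (m i.2)) : S) *: m i.1.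
  have [u au uE] := rank1 _ (f i.2) i.1 (wa (f i.1) (m i.2)).
  by exists u; split=> // x; rewrite uE antiK.
(* Expanding by the dual basis both before and after the action of [w] writes it as a sum of such
   rank-one endomorphisms; the action is faithful. *)
have -> : w = \sum_i v i.
  apply: dual_act_inj => x.
  have actD : {morph (fun u => dual_act u x) : u u' / u + u'}.
    by move=> u u'; rewrite -[u]scale1r dual_actP !scale1r.
  rewrite [RHS](big_morph _ actD (dual_act0 x)) [LHS]fm.
  under [RHS]eq_bigr => i _ do rewrite (vP i).2.
  rewrite -(pair_bigA _ (fun j k =>
    (f k x * f j (dual_act w (m k)) : S) *: m j)).
  apply: eq_bigr => j _; rewrite -scaler_suml; congr (_ *: _).
  rewrite [in LHS](fm x) !linear_sum; apply: eq_bigr => k _.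
  by rewrite !linearZZ.
by elim/big_rec: _ => // i x _ ax; apply: aP => //; exact: (vP i).1.
Qed.

(** With t(U) the trace ideal of [U], any ideal [U] containing t(U) equals it, by induction on the
    dimension. If [W] = t(U) were smaller, then t(W) = W by induction, so t(U) = t(W) and reflection
    would put [U] inside [W]. The case of [U] the whole of [T] is the claim. *)
Lemma trace_ideal_full (x : T) : trace_ideal (fun _ => True) x.
Proof.
suff main n (U : {vspace T}) : (\dim U <= n)%N ->
    two_sided_ideal (fun x => x \in U) ->
    (forall x, trace_ideal (fun x => x \in U) x -> x \in U) ->
    forall x, x \in U -> trace_ideal (fun x => x \in U) x.
  apply: (@trace_idealS (fun x => x \in {:T}%VS)) => //.
  apply: (main _ {:T}%VS (leqnn _)); last exact: memvf.
    by split=> *; exact: memvf.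
  by move=> *; exact: memvf.
elim: n U => [|n IHn] U; rewrite ?leqn0 => Un Uideal UT y Uy.
  move: Un Uy; rewrite dimv_eq0 => /eqP ->; rewrite memv0 => /eqP ->.
  exact: TraceIdeal0.
have [b0 blin bmull bmulr] := trace_ideal_ideal (fun x => x \in U).
have [W WP] := exists_vspace b0 blin.
have WU : (W <= U)%VS by apply/subvP => z /WP; exact: UT.
have WE : (fun x => x \in W : Prop) = trace_ideal (fun x => x \in U).
  by apply/funext => z; apply/propext; exact: WP.
have [dWU|dWU] := leqP (\dim U) (\dim W).
  by have /eqP WeU : W == U; rewrite ?eqEdim ?WU //; apply/WP; rewrite WeU.
have IHW : forall x, x \in W -> trace_ideal (fun x => x \in W) x.
  apply: IHn.
  - by rewrite -ltnS (leq_trans dWU).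
  - by rewrite WE; exact: trace_ideal_ideal.
  - by move=> z zW; apply/WP; apply: trace_idealS zW; exact/subvP.
apply/WP.
apply: (@trace_ideal_reflect (fun x => x \in W)).
  by rewrite WE; exact: trace_ideal_ideal.
by move=> f m; apply: IHW; apply/WP; exact: TraceIdeal_gen.
Qed.

Lemma finite_projective_generator : dual_generator op.
Proof.
suff main x : trace_ideal (fun _ => True) x ->
    exists L : seq ({linear dual -> S^o} * dual),
      op (\sum_(p <- L) p.1 p.2) = x.
  have [L LE] := main _ (trace_ideal_full 1).
  by exists L; rewrite -[LHS](antiK op) LE antiV1.
elim=> [u f m _||k y z _ [L1 <-] _ [L2 <-]].
- by exists [:: (f, dual_act u m)]; rewrite big_seq1.
- by exists [::]; rewrite big_nil linear0.
exists ([seq (p.1, k%:A *: p.2) | p <- L1] ++ L2).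
rewrite big_cat big_map -linearP; congr (op (_ + _)).
rewrite scaler_sumr; apply: eq_bigr => p _.
by rewrite linearZZ; exact: mulr_algl.
Qed.

End TraceIdeal.

(** * Frobenius algebras *)

Section Frobenius.
Variables (K : fieldType) (S T : falgType K) (op : anti_iso S T).

Local Notation coind := (homK op (T^o : lmodType T)).
Local Notation dual := (coind (K^o : lmodType K)).

(** As an injective module, [T] is a retract of Hom_K(S, T), a finite sum of copies of the dual of
    [S]. Dualizing makes the dual of [T] a retract of a free S-module of finite rank, whose basis
    yields the dual basis. *)
Lemma injective_dual_projective :
  injective_mod (T^o : lmodType T) -> dual_finite_projective op.
Proof.
move=> Tinj; have [r rK] := injective_coind_retract (anti_sym op) Tinj.
pose b i : S := (vbasis {:S})`_i.
pose tens (m : homK (anti_sym op) (S^o : lmodType S) (K^o : lmodType K)) j :=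
  tensor m (op (b j) : restr (T^o : lmodType T)).
(* By double duality, [F j x] is the element of [S] on which each functional [m] takes the value
   [x (r (tens m j))]. *)
pose F j (x : dual) : S :=
  \sum_(i < \dim {:S}) (x (r (tens (dual_coord _ i) j)) : K) *: b i.
have FE j x (m : homK (anti_sym op) (S^o : lmodType S) (K^o : lmodType K)) :
    m (F j x) = x (r (tens m j)).
  rewrite /F homK_sumr [in RHS](dual_decomp m) /tens tensor_suml linear_sum.
  rewrite homK_sumr; apply: eq_bigr => i _.
  rewrite tensorZl linearZZ -(restrZ (A := T^o)) homKZ.
  by rewrite -restr_regularZ homKZ; exact: mulrC.
have Flin j : linear (F j : dual -> S^o).
  move=> s x y; apply: (@dual_separates _ _ _ (anti_sym op)) => m.
  have mE (z : S^o) : m (s *: z) = (op s *: m) z by rewrite homKZE /= antiK.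
  rewrite FE homKDE homKZE (homKD m) mE !FE.
  by rewrite /tens tensorZl linearZZ.
exists (\dim {:S}), (fun j => linear_map (Flin j)).
exists (fun j => HomK (homK_regularP (V := K^o) (linearP
  (coord (vbasis {:S}) j \o anti_inv op)))).
move=> x; apply: homK_ext => t; rewrite homK_sumE.
transitivity (\sum_j x (r (t *: tens (dual_coord (anti_sym op) j) j))).
  rewrite -homK_sumr -linear_sum -scaler_sumr linearZZ.
  (* The embedding sends 1 to the map [op], whose expansion along the basis [b] is this sum, and [r]
     sends it back to 1. *)
  have <- : coind_embed (anti_sym op) T^o 1 =
      \sum_j tens (dual_coord (anti_sym op) j) j.
    rewrite [LHS]coind_decomp; apply: eq_bigr => j _; congr (tensor _ _).
    by rewrite coind_embedE; exact: mulr1.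
  by rewrite rK; congr (x _); exact/esym/mulr1.
apply: eq_bigr => j _; rewrite -tensorZl -FE homKZE /=.
by rewrite antiVM antiK.
Qed.

(** The pairs in [L] define a map onto [P] from the module coinduced from a finite power of [P],
    which is injective for [P] of any size. Projectivity of [P] splits this surjection. *)
Lemma generator_projective_injective (P : lmodType S) :
  dual_generator op -> projective_mod P -> injective_mod P.
Proof.
move=> [L L1] Pproj; pose N := size L.
pose p (s : 'I_N) := tnth (in_tuple L) s.
have projL (s : 'I_N) :
    linear (fun v : {ffun 'I_N -> restr P} => v s : restr P).
  by move=> k x y; rewrite !ffunE.
pose V : lmodType K := {ffun 'I_N -> restr P}.
pose F (h : coind V) : P :=
  \sum_s coind_lift (p s).1 (linear_map (projL s)) h.
have Flin : linear F.
  move=> k x y; rewrite /F scaler_sumr -big_split; apply: eq_bigr => s _.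
  exact: linearPZ.
have Fsurj x : exists h, linear_map Flin h = x.
  (* The preimage of [x] is the sum over [s] of the tensors of [(p s).2] with [x] placed in
     coordinate [s]. *)
  have hL : linear (fun t : restr (T^o : lmodType T) =>
      [ffun s => ((p s).2 t : K) *: (x : restr P)] : V).
    move=> k t u; apply/ffunP => s; rewrite !ffunE homKP.
    by rewrite scalerDl scalerA.
  exists (HomK hL); rewrite linear_mapE /F.
  transitivity (\sum_s ((p s).1 (p s).2 : S) *: x).
    apply: eq_bigr => s _.
    rewrite -[RHS](coind_lift_tensor (V := restr P) (p s).1 (@idfun (restr P))).
    rewrite !coind_liftE; apply: eq_bigr => i _.
    by rewrite /= ffunE.
  rewrite -scaler_suml -[RHS]scale1r; congr (_ *: _).
  by rewrite -L1 [RHS]big_tnth.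
have [g gE] := Pproj _ _ (linear_map Flin) (@idfun P) Fsurj.
exact: retract_injective gE (coind_injective (V := V)).
Qed.

(** For each [j], the K-linear map [v |-> g (tensor (m j) v)] lifts along [pi] to some [c j], vector
    spaces being projective. The sum of the S-linear maps built from [f j] and [c j] then lifts [g]
    by the dual basis identity. *)
Lemma finite_projective_coind_projective (V : lmodType K) :
  dual_finite_projective op -> projective_mod (coind V : lmodType S).
Proof.
move=> [n [f [m fm]]] A B pi g pi_surj.
have tL j : linear (fun v => g (tensor (m j) v) : restr B).
  move=> k x y; rewrite -(linearP (restr_map g)); congr (g _).
  exact: tensor_linear.
have /choice[c cE] j : exists c : {linear V -> restr A},
    forall v, pi (c v) = g (tensor (m j) v).
  exact: vector_space_projective (restr_map pi) (linear_map (tL j)) pi_surj.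
pose G (h : coind V) : A := \sum_j coind_lift (f j) (c j) h.
have Glin : linear G.
  move=> k x y; rewrite /G scaler_sumr -big_split; apply: eq_bigr => s _.
  exact: linearPZ.
exists (linear_map Glin) => h; rewrite /= /G linear_sum.
rewrite [in RHS](coind_decomp h) linear_sum.
under eq_bigr => j _ do rewrite coind_liftE linear_sum.
rewrite exchange_big; apply: eq_bigr => i _.
rewrite [in RHS](fm (dual_coord op i)) tensor_suml linear_sum.
by apply: eq_bigr => j _; rewrite linearZZ cE tensorZl linearZZ.
Qed.

Lemma finite_projective_injective_projective (E : lmodType S) :
  dual_finite_projective op -> injective_mod E -> projective_mod E.
Proof.
move=> fproj /(injective_coind_retract op)[r rK].
exact: retract_projective rK (finite_projective_coind_projective fproj).
Qed.

End Frobenius.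

(** * Totally acyclic complexes *)

Section KernelModule.
Variables (S : pzRingType) (B C : lmodType S) (g : {linear B -> C}).

Definition in_ker : {pred B} := [pred x | g x == 0].

Fact in_ker_submod : submod_closed in_ker.
Proof.
split; rewrite ?inE ?linear0 // => s x y /eqP gx /eqP gy.
by rewrite inE linearP gx gy scaler0 addr0.
Qed.

HB.instance Definition _ := GRing.isSubmodClosed.Build S B in_ker in_ker_submod.

Record ker_mod := KerMod { ker_val :> B; _ : ker_val \in in_ker }.

HB.instance Definition _ := [isSub for ker_val].
HB.instance Definition _ := [Choice of ker_mod by <:].
HB.instance Definition _ := [SubChoice_isSubLmodule of ker_mod by <:].

Lemma ker_modP (x : ker_mod) : g (val x) = 0.
Proof. exact/eqP/(valP x). Qed.

Lemma ker_mod_lift (A : lmodType S) (f : {linear A -> B}) :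
  (forall a, g (f a) = 0) ->
  exists h : {linear A -> ker_mod}, forall a, val (h a) = f a.
Proof.
move=> gf; have fP a : f a \in in_ker by apply/eqP.
have hL : linear (fun a => KerMod (fP a)).
  by move=> s x y; apply: val_inj; rewrite /= linearP.
by exists (linear_map hL).
Qed.

End KernelModule.

Section TotallyAcyclic.
Variables (S : pzRingType) (X : complex S).
Hypothesis Xacyclic : acyclic X.

(** By acyclicity the differential maps onto the kernel of the next one, so [phi] lifts. Where
    injectives are projective, this is the condition for total acyclicity of complexes of
    injectives. *)
Lemma projective_Hom_from_exact (M : lmodType S) :
  projective_mod M -> Hom_from_exact M X.
Proof.
move=> Mproj i phi; split=> [dphi|[psi phiE] m]; last first.
  by rewrite -phiE /= cdiff_comp0.
have [d dE] := ker_mod_lift (@cdiff_comp0 _ X i).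
have [p pE] := ker_mod_lift dphi.
have [|psi psiE] := Mproj _ _ d p.
  move=> b; have /Xacyclic[a ab] := ker_modP b.
  by exists a; apply: val_inj; rewrite dE.
by exists psi => m; rewrite -[RHS]pE -psiE /= dE.
Qed.

Lemma injective_Hom_to_exact (M : lmodType S) :
  injective_mod M -> Hom_to_exact X M.
Proof.
move=> Minj i phi; split=> [phid|[psi phiE] x]; last first.
  by rewrite -phiE /= cdiff_comp0 linear0.
(* As [phi] kills boundaries, it descends to the image of the differential, which is [Z] by
   acyclicity; it then extends from [Z] to the whole term. *)
pose Z := ker_mod (cdiff X (i + 1 + 1)).
have /choice[s sP] (z : Z) : exists x, cdiff X (i + 1) x = val z.
  exact/Xacyclic/ker_modP.
have phiE x y : cdiff X (i + 1) x = cdiff X (i + 1) y -> phi x = phi y.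
  move=> /eqP; rewrite -subr_eq0 -linearB => /eqP/Xacyclic[w wE].
  by apply/eqP; rewrite -subr_eq0 -linearB -wE phid.
have gL : linear (fun z : Z => phi (s z)).
  by move=> a x y; rewrite -linearP; apply: phiE; rewrite linearP !sP.
have [psi psiE] := Minj Z _ val (linear_map gL) val_inj.
have [d dE] := ker_mod_lift (@cdiff_comp0 _ X (i + 1)).
exists psi => x; rewrite /= -dE -[LHS]/((psi \o val) (d x)) psiE.
by apply: phiE; rewrite sP dE.
Qed.

End TotallyAcyclic.

(** * One-sided exact sequences as complexes over the integers *)

Section HalfComplexes.
Variable S : pzRingType.

Definition zero_mod : lmodType S := 'rV[S]_0.

Lemma zero_mod_eq (x y : zero_mod) : x = y.
Proof. by apply/matrixP => i []. Qed.

Lemma zero_mod_projective : projective_mod zero_mod.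
Proof.
move=> A B f g _; exists \0 => x.
by rewrite /= linear0 (zero_mod_eq x 0) linear0.
Qed.

Lemma zero_mod_injective : injective_mod zero_mod.
Proof. by move=> A B f g _; exists \0 => x; exact: zero_mod_eq. Qed.

(** The successor by cases on constructors, so that terms indexed by it reduce. *)
Definition next_int (i : int) : int :=
  match i with Posz n => Posz n.+1 | Negz 0 => 0 | Negz n.+1 => Negz n end.

Lemma next_intE i : i + 1 = next_int i.
Proof.
case: i => [n|[|n]] //=; first by rewrite -[n.+1]addn1 PoszD.
by rewrite !NegzE -[n.+2]addn1 PoszD opprD subrK.
Qed.

Section Up.
Variables (N : nat -> lmodType S) (d : forall n, {linear N n -> N n.+1}).
Hypothesis d0_inj : injective (d 0).
Hypothesis d_exact : forall n, exact_at (d n) (d n.+1).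

Definition up_term (i : int) : lmodType S :=
  if i is Posz n then N n else zero_mod.

(** Stated for arbitrary [i] and [j] because the type at [i + 1] does not reduce for a variable [i];
    only consecutive indices give a nonzero map. *)
Definition up_map (i j : int) : {linear up_term i -> up_term j} :=
  match i, j with
  | Posz n, Posz m => if n.+1 =P m is ReflectT e
                      then ecast m {linear N n -> N m} e (d n) else \0
  | _, _ => \0
  end.

Lemma up_mapE (n : nat) : up_map n n.+1 = d n.
Proof. by rewrite /=; case: eqP => // e; rewrite (eq_axiomK e). Qed.

Lemma up_exact i j k : i + 1 = j -> j + 1 = k ->
  exact_at (up_map i j) (up_map j k).
Proof.
rewrite !next_intE => <- <- {j k}; case: i => [n|[|[|n]]].
- by have := @d_exact n; rewrite -(up_mapE n) -(up_mapE n.+1).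
(* In degree 0 the incoming map is zero, and exactness is injectivity of [d 0]. *)
- rewrite -[next_int _]/(Posz 0) -[next_int _]/(Posz 1) up_mapE => b.
  split=> [|[a <-]]; last exact: linear0.
  by rewrite -[X in _ = X -> _](linear0 (d 0)) => /d0_inj ->; exists 0.
- by move=> b; split=> // _; exists 0; exact: zero_mod_eq.
- by move=> b; split=> // _; exists 0; exact: zero_mod_eq.
Qed.

Lemma up_map_comp0 i x : up_map (i + 1) (i + 1 + 1) (up_map i (i + 1) x) = 0.
Proof. by apply/(up_exact erefl erefl); exists x. Qed.

Definition up_complex : complex S := Complex up_map_comp0.

Lemma up_complex_acyclic : acyclic up_complex.
Proof. by move=> i; exact: up_exact. Qed.

End Up.

Section Down.
Variables (N : nat -> lmodType S) (d : forall n, {linear N n.+1 -> N n}).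
Hypothesis d0_surj : forall x, exists y, d 0 y = x.
Hypothesis d_exact : forall n, exact_at (d n.+1) (d n).

(** Since [Negz n] is -(n+1), the module [N 0] sits in degree -1, where exactness is surjectivity of
    [d 0]. *)
Definition down_term (i : int) : lmodType S :=
  if i is Negz n then N n else zero_mod.

Definition down_map (i j : int) : {linear down_term i -> down_term j} :=
  match i, j with
  | Negz n, Negz m => if m.+1 =P n is ReflectT e
                      then ecast n {linear N n -> N m} e (d m) else \0
  | _, _ => \0
  end.

Lemma down_mapE n : down_map (Negz n.+1) (Negz n) = d n.
Proof. by rewrite /=; case: eqP => // e; rewrite (eq_axiomK e). Qed.

Lemma down_exact i j k : i + 1 = j -> j + 1 = k ->
  exact_at (down_map i j) (down_map j k).
Proof.
rewrite !next_intE => <- <- {j k}; case: i => [n|[|[|n]]].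
- by move=> b; split=> // _; exists 0; exact: zero_mod_eq.
- by move=> b; split=> // _; exists 0; exact: zero_mod_eq.
- rewrite -[next_int (Negz 1)]/(Negz 0) -[next_int _]/(Posz 0) down_mapE => b.
  by split=> // _; exact: d0_surj.
- by have := @d_exact n; rewrite -(down_mapE n) -(down_mapE n.+1).
Qed.

Lemma down_map_comp0 i x :
  down_map (i + 1) (i + 1 + 1) (down_map i (i + 1) x) = 0.
Proof. by apply/(down_exact erefl erefl); exists x. Qed.

Definition down_complex : complex S := Complex down_map_comp0.

Lemma down_complex_acyclic : acyclic down_complex.
Proof. by move=> i; exact: down_exact. Qed.

End Down.
End HalfComplexes.

Section CoresolvedModule.
Variables (S : pzRingType) (M : lmodType S) (E : min_inj_cores M).

Definition aug_term (n : nat) : lmodType S := if n is m.+1 then E m else M.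

Definition aug_diff (n : nat) : {linear aug_term n -> aug_term n.+1} :=
  match n with 0 => icores_aug E | m.+1 => icores_diff E m end.

Lemma aug_exact n : exact_at (aug_diff n) (aug_diff n.+1).
Proof. case: n => [|n]; [exact: icores_exact0|exact: icores_exactS]. Qed.

Lemma aug_term_projective :
  projective_mod M -> (forall i, projective_mod (E i)) ->
  forall n, projective_mod (aug_term n).
Proof. by move=> ? ? []. Qed.

End CoresolvedModule.

(** * Self-injective algebras and the equivalence *)

Section SelfInjective.
Variables (K : fieldType) (S T : falgType K) (op : anti_iso S T).

(** The retraction is the transpose of [s] under double duality: [r e] is the element of [T] on
    which every functional [m] takes the value [s m e]. *)
Lemma dual_retraction (E : lmodType T) (i : {linear (T^o : lmodType T) -> E})
    (s : {linear homK op (T^o : lmodType T) (K^o : lmodType K) ->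
                 homK op E (K^o : lmodType K)}) :
  (forall phi, homK_comp op (K^o : lmodType K) i (s phi) = phi) ->
  exists r : {linear E -> (T^o : lmodType T)}, cancel i r.
Proof.
move=> sE; pose r (e : E) : T :=
  \sum_(j < \dim {:T}) (s (dual_coord op j) e : K) *: (vbasis {:T})`_j.
have rE (m : homK op (T^o : lmodType T) (K^o : lmodType K)) e :
    m (r e) = s m e.
  rewrite [in RHS](dual_decomp m) linear_sum homK_sumE /r homK_sumr.
  apply: eq_bigr => j _; rewrite linearZZ homK_algZE -restr_regularZ homKZ.
  exact: mulrC.
have rL : linear (r : E -> (T^o : lmodType T)).
  move=> t x y; apply: (@dual_separates _ _ _ op) => m.
  rewrite rE homKD (homKD m) rE; congr (_ + _).
  have mE (z : T^o) : m (t *: z) = (anti_inv op t *: m) z.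
    by rewrite homKZE antiVK.
  by rewrite mE rE linearZZ homKZE antiVK.
exists (linear_map rL) => x; apply: (@dual_separates _ _ _ op) => m.
by rewrite linear_mapE rE -homK_compE sE.
Qed.

Lemma self_injective_frobenius : self_injective T ->
  (forall P : lmodType S, projective_mod P -> injective_mod P) /\
  (forall E : lmodType S, injective_mod E -> projective_mod E).
Proof.
move=> /(injective_dual_projective op) fproj; split=> M.
  exact/(generator_projective_injective (finite_projective_generator fproj)).
exact: (finite_projective_injective_projective fproj).
Qed.

End SelfInjective.

Section Corollary.
Variables (K : fieldType) (R : falgType K).

(** Injectivity on one side makes projectives injective on the other, in particular the regular
    module. *)
Lemma self_injective_converse : self_injective R -> self_injective R^c.
Proof.
move=> /(@self_injective_frobenius K R^c R (anti_sym (converse_anti R)))[+ _].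
by apply; exact: regular_projective.
Qed.

Lemma self_injective_quasi_frobenius : self_injective R ->
  ((forall P : lmodType R, projective_mod P -> injective_mod P) /\
   (forall E : lmodType R, injective_mod E -> projective_mod E)) /\
  ((forall P : lmodType R^c, projective_mod P -> injective_mod P) /\
   (forall E : lmodType R^c, injective_mod E -> projective_mod E)).
Proof.
move=> Rinj; split; last first.
  exact: (@self_injective_frobenius K R^c R (anti_sym (converse_anti R)) Rinj).
have := self_injective_converse Rinj.
exact: (@self_injective_frobenius K R R^c (converse_anti R)).
Qed.

Hypothesis R_domdim : infinite_dominant_dimension R.

Lemma acyclic_proj_self_injective :
    (forall X : complex R, acyclic_proj X -> totally_acyclic_proj X) ->
  self_injective R.
Proof.
move=> totR; have [E Eproj] := R_domdim.
pose X := up_complex (d := aug_diff E)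
  (@icores_aug_inj _ _ E) (@aug_exact _ _ E).
have Xproj : acyclic_proj X.
  split=> [|[n|n]]; first exact: up_complex_acyclic.
    exact/aug_term_projective/Eproj/regular_projective.
  exact: zero_mod_projective.
have [_ totX] := totR X Xproj.
(* [Negz 0] is -1: this is exactness at maps out of degree 0, where [R] sits, and the incoming
   differential is zero. *)
have [+ _] := totX _ (@regular_projective R) (Negz 0) (@idfun R^o).
case=> [x|r rE]; first by [].
apply: (@retract_injective _ _ _ (icores_aug E) r); last exact: icores_inj.
move=> x; rewrite (_ : icores_aug E = up_map (aug_diff E) 0 1).
  exact: rE.
exact: esym (up_mapE (aug_diff E) 0).
Qed.

Lemma acyclic_inj_self_injective :
    (forall X : complex R^c, acyclic_inj X -> totally_acyclic_inj X) ->
  self_injective R.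
Proof.
move=> totR; have [E Eproj] := R_domdim.
pose D (A : lmodType R) :=
  homK (anti_sym (converse_anti R)) A (K^o : lmodType K) : lmodType R^c.
pose d n : {linear D (aug_term E n.+1) -> D (aug_term E n)} :=
  homK_comp _ _ (aug_diff E n).
have d0_surj x : exists y, d 0%N y = x.
  exact/homK_comp_surj/(@icores_aug_inj _ _ E).
have d_exact n : exact_at (d n.+1) (d n) by exact/homK_exact/aug_exact.
pose X := down_complex d0_surj d_exact.
have Xinj : acyclic_inj X.
  split=> [|[n|n]]; first exact: down_complex_acyclic.
    exact: zero_mod_injective.
  exact/homK_injective/aug_term_projective/Eproj/regular_projective.
have Dinj : injective_mod (D (R^o : lmodType R)).
  exact/homK_injective/regular_projective.
(* [Negz 1] is -2: the identity of the dual of [R], in degree -1, is lifted to the dual of [E 0],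
   the outgoing differential being zero. *)
have [_ /(_ _ Dinj (Negz 1) (@idfun _))[+ _]] := totR X Xinj.
case=> [x|s sE]; first by [].
have [phi|r rE] := @dual_retraction _ _ _ _ _ (icores_aug E) s.
  rewrite (_ : homK_comp _ _ _ = down_map d (Negz 1) (Negz 0)); first exact: sE.
  exact: esym (down_mapE d 0).
exact: retract_injective rE (@icores_inj _ _ E 0).
Qed.

End Corollary.

Theorem corollary1p5 (K : fieldType) (R : falgType K)
    (R_domdim : infinite_dominant_dimension R) :
  [<-> (* (i) *)
       self_injective R;
       (* (ii) *)
       (forall X : complex R, acyclic_inj X -> totally_acyclic_inj X) /\
       (forall X : complex R^c, acyclic_inj X -> totally_acyclic_inj X);
       (* (iii) *)
       (forall X : complex R, acyclic_proj X -> totally_acyclic_proj X) /\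
       (forall X : complex R^c, acyclic_proj X -> totally_acyclic_proj X)].
Proof.
tfae.
- move=> /self_injective_quasi_frobenius[[_ ip] [_ ipc]].
  split=> X Xinj; split=> // M /[dup] Minj.
    by move/ip; apply: projective_Hom_from_exact; case: Xinj.
  by move/ipc; apply: projective_Hom_from_exact; case: Xinj.
(* The passage from (ii) to (iii) goes through (i). *)
- move=> [_ /(acyclic_inj_self_injective R_domdim)].
  move=> /self_injective_quasi_frobenius[[pi _] [pic _]].
  split=> X Xproj; split=> // M Mproj.
    by apply: injective_Hom_to_exact (pi _ Mproj); case: Xproj.
  by apply: injective_Hom_to_exact (pic _ Mproj); case: Xproj.
- by move=> [/(acyclic_proj_self_injective R_domdim)].
Qed.
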